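(* A Boolean product distribution $\mathcal{D}(p)$ on $\Pi_d=\{0,1\}^d$ is identifiable from its truncation $\mathcal{D}_S$ if and only if the following condition holds: (after possible normalization of $S$) $\mathcal{D}_S(\mathbf{0})>0$ and there are $d$ linearly independent vectors $x^{(1)},\dots,x^{(d)}\in S$ with $\mathcal{D}_S(x^{(j)})>0$ for all $j\in[d]$.
   Context: A Boolean product distribution $\mathcal{D}(p)$ with parameter vector $p=(p_1,\dots,p_d)$, $p_i\in(0,1)$, is the product of $d$ independent Bernoulli distributions with parameters $p_i$. For $S\subseteq\Pi_d$, the truncation $\mathcal{D}_S$ has $\mathcal{D}_S(x)=\mathcal{D}(x)/\mathcal{D}(S)$ for $x\in S$ and $0$ otherwise, where $\mathcal{D}(S)=\sum_{x\in S}\mathcal{D}(x)$. $\mathcal{D}(p)$ is identifiable from its truncation $\mathcal{D}_S(p)$ if, given $\mathcal{D}_S(p;x)$ for all $x\in S$, we can recover the parameter vector $p$. Normalization of $S$: by swapping $1$ with $0$ (and $p_i$ with $1-p_i$) in certain coordinates, one can arrange that $\mathbf{0}\in S$ and $\mathcal{D}_S(\mathbf{0})>0$; it is assumed without loss of generality that $S$ is normalized in this way. Linear independence is over $\mathbb{R}$. *)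

(* Defs.v *)
From mathcomp Require Import all_boot all_order all_algebra.
From mathcomp Require Import reals bernoulli_distribution.

Set Implicit Arguments.
Unset Strict Implicit.
Unset Printing Implicit Defensive.

Import Order.TTheory GRing.Theory Num.Theory.

Local Open Scope ring_scope.

Notation cube d := {ffun 'I_d -> bool}.

Definition origin (d : nat) : cube d := [ffun => false].

Definition vec_of (R : realType) (d : nat) (x : cube d) : 'rV[R]_d :=
  \row_i (x i)%:R.

Definition open_unit (R : realType) (d : nat) (p : {ffun 'I_d -> R}) : Prop :=
  forall i, 0 < p i < 1.

Definition prod_pmf (R : realType) (d : nat) (p : {ffun 'I_d -> R})
    (x : cube d) : R :=
  \prod_i bernoulli_pmf (p i) (x i).

Definition mass (R : realType) (d : nat) (p : {ffun 'I_d -> R})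
    (S : {set cube d}) : R :=
  \sum_(x in S) prod_pmf p x.

Definition trunc_pmf (R : realType) (d : nat) (p : {ffun 'I_d -> R})
    (S : {set cube d}) (x : cube d) : R :=
  if x \in S then prod_pmf p x / mass p S else 0.

(* Recoverability of [p] from the values of its truncation on [S]: no other
   parameter vector in (0,1)^d produces the same values. *)
Definition identifiable (R : realType) (d : nat) (p : {ffun 'I_d -> R})
    (S : {set cube d}) : Prop :=
  forall q : {ffun 'I_d -> R}, open_unit q ->
    (forall x, x \in S -> trunc_pmf q S x = trunc_pmf p S x) -> q = p.

(* Normalization swaps 0 and 1 (and p_i with 1 - p_i) in the coordinates
   selected by [a]. *)
Definition flip (d : nat) (a x : cube d) : cube d := [ffun i => a i (+) x i].

Definition flip_set (d : nat) (a : cube d) (S : {set cube d}) : {set cube d} :=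
  [set flip a x | x in S].

Definition flip_param (R : realType) (d : nat) (a : cube d)
    (p : {ffun 'I_d -> R}) : {ffun 'I_d -> R} :=
  [ffun i => if a i then 1 - p i else p i].

Definition spanning_condition (R : realType) (d : nat) (p : {ffun 'I_d -> R})
    (S : {set cube d}) : Prop :=
  0 < trunc_pmf p S (origin d) /\
  exists x : 'I_d -> cube d,
    [/\ forall j, x j \in S,
        row_free (\matrix_(j < d) vec_of R (x j))
      & forall j, 0 < trunc_pmf p S (x j)].

(* Main.v *)
(** With [logit t = ln (t / (1 - t))] one has
    [D(p; x) = D(p; 0) * exp (x . logit p)], so when [0] lies in [S] the
    truncations of [D(p)] and [D(q)] agree on [S] iff [logit q - logit p] is
    orthogonal to [S].  As [logit] is a bijection from (0,1) to the reals,
    [p] is identifiable iff [S] spans the whole space.  Flipping coordinates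
    changes neither side, which reduces the general case to [0] in [S]. *)
Require Import Defs.
From mathcomp Require Import all_boot all_order all_algebra.
From mathcomp Require Import reals.
From mathcomp Require Import bernoulli_distribution exp sequences.
From mathcomp Require Import ring lra.

Set Implicit Arguments.
Unset Strict Implicit.
Unset Printing Implicit Defensive.

Import Order.TTheory GRing.Theory Num.Theory.

Local Open Scope ring_scope.

Section Flip.
Variables (R : realType) (d : nat).
Implicit Types (p q : {ffun 'I_d -> R}) (a x : cube d) (S : {set cube d}).

Lemma flipK a : involutive (flip a).
Proof. by move=> x; apply/ffunP => i; rewrite !ffunE addKb. Qed.

Lemma flip_self x : flip x x = origin d.
Proof. by apply/ffunP => i; rewrite !ffunE addbb. Qed.

Lemma flip_setK a : involutive (flip_set a).
Proof.
move=> S; rewrite /flip_set -imset_comp -[RHS]imset_id.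
by apply: eq_imset => x /=; rewrite flipK.
Qed.

Lemma mem_flip_set a S x : (flip a x \in flip_set a S) = (x \in S).
Proof. by rewrite mem_imset //; exact: can_inj (flipK a). Qed.

Lemma flip_paramK a : involutive (@flip_param R d a).
Proof.
by move=> p; apply/ffunP => i; rewrite !ffunE; case: (a i) => //; ring.
Qed.

Lemma open_unit_flip a p : open_unit p -> open_unit (flip_param a p).
Proof.
by move=> hp i; rewrite ffunE; have := hp i; case: (a i) => //; lra.
Qed.

Lemma prod_pmf_flip a p x : prod_pmf (flip_param a p) (flip a x) = prod_pmf p x.
Proof.
apply: eq_bigr => i _; rewrite !ffunE /bernoulli_pmf.
by case: (a i) (x i) => [] [] //=; ring.
Qed.

Lemma trunc_pmf_flip a p S x :
  trunc_pmf (flip_param a p) (flip_set a S) (flip a x) = trunc_pmf p S x.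
Proof.
rewrite /trunc_pmf mem_flip_set prod_pmf_flip /mass big_imset /=; last first.
  by apply: in2W; exact: can_inj (flipK a).
by under eq_bigr do rewrite prod_pmf_flip.
Qed.

(** A competitor of the flipped parameter flips back to a competitor of [p]. One implication is
    enough: flips are involutions, so the converse is an instance of it. *)
Lemma identifiable_flip_sub a p S :
  identifiable p S -> identifiable (flip_param a p) (flip_set a S).
Proof.
move=> idp q hq eq_qp; apply: (can_inj (flip_paramK a)); rewrite flip_paramK.
apply: idp => [|x xS]; first exact: open_unit_flip.
by rewrite -(trunc_pmf_flip a) flip_paramK eq_qp ?mem_flip_set // trunc_pmf_flip.
Qed.

Lemma identifiable_flip a p S :
  identifiable (flip_param a p) (flip_set a S) <-> identifiable p S.
Proof.
split=> [/(@identifiable_flip_sub a)|]; last exact: identifiable_flip_sub.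
by rewrite flip_paramK flip_setK.
Qed.

End Flip.

Section Logit.
Variable R : realType.
Implicit Types t y : R.

Definition logit t : R := ln (t / (1 - t)).
Definition sigmoid y : R := expR y / (1 + expR y).

Lemma expR_logit t : 0 < t < 1 -> expR (logit t) = t / (1 - t).
Proof. by move=> /andP[t0 t1]; rewrite lnK // posrE divr_gt0 // subr_gt0. Qed.

Lemma sigmoid_unit y : 0 < sigmoid y < 1.
Proof.
have e0 := expR_gt0 y; have e1 : 0 < 1 + expR y by lra.
by rewrite divr_gt0 // ltr_pdivrMr // mul1r ltrDr ltr01.
Qed.

Lemma logitK t : 0 < t < 1 -> sigmoid (logit t) = t.
Proof.
by move=> ht; rewrite /sigmoid expR_logit //; field; apply/andP; split; lra.
Qed.

Lemma sigmoidK y : logit (sigmoid y) = y.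
Proof.
have e0 := expR_gt0 y; rewrite /logit /sigmoid -[RHS]expRK; congr ln.
by field; apply/andP; split; lra.
Qed.

End Logit.

Section Identifiability.
Variables (R : realType) (d : nat).
Implicit Types (p q : {ffun 'I_d -> R}) (x : cube d) (S : {set cube d}).

Definition logit_col p : 'cV[R]_d := \col_i logit (p i).

Lemma prod_pmf_gt0 p x : open_unit p -> 0 < prod_pmf p x.
Proof.
move=> hp; apply: prodr_gt0 => i _; rewrite /bernoulli_pmf.
by have := hp i; case: (x i); lra.
Qed.

Lemma mass_gt0 p S x : open_unit p -> x \in S -> 0 < mass p S.
Proof.
move=> hp xS; rewrite /mass (bigD1 x) //= ltr_pwDl ?prod_pmf_gt0 //.
by apply: sumr_ge0 => y _; rewrite ltW ?prod_pmf_gt0.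
Qed.

(** Parameters in (0,1) give every point positive mass, so the positivity clauses of
    [spanning_condition] reduce to membership in [S]. *)
Lemma trunc_pmf_gt0 p S x : open_unit p -> (0 < trunc_pmf p S x) = (x \in S).
Proof.
move=> hp; rewrite /trunc_pmf; case: ifP => xS; last by rewrite ltxx.
by rewrite divr_gt0 ?prod_pmf_gt0 ?(mass_gt0 hp xS).
Qed.

(** Coordinatewise, [p i = (1 - p i) * expR (logit (p i))]: each 1 in [x] contributes one odds
    factor. *)
Lemma prod_pmf_expR p x : open_unit p ->
  prod_pmf p x = prod_pmf p (origin d) * expR ((vec_of R x *m logit_col p) 0 0).
Proof.
move=> hp; rewrite mxE expR_sum -big_split; apply: eq_bigr => i _ /=.
rewrite !mxE ffunE /bernoulli_pmf; have := hp i.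
case: (x i) => hi; last by rewrite mul0r expR0 mulr1.
by rewrite mul1r expR_logit //; field; lra.
Qed.

(** Dividing by the value at the origin eliminates both masses and leaves an equality of
    exponentials. Conversely, orthogonality makes the two product weights proportional on [S], and
    normalizing cancels the factor. *)
Lemma eq_trunc_pmfP p q S : open_unit p -> open_unit q -> origin d \in S ->
  (forall x, x \in S -> trunc_pmf q S x = trunc_pmf p S x) <->
  (forall x, x \in S -> vec_of R x *m (logit_col q - logit_col p) = 0).
Proof.
move=> hp hq S0.
have q0 : prod_pmf q (origin d) != 0 by rewrite gt_eqF ?prod_pmf_gt0.
have p0 : prod_pmf p (origin d) != 0 by rewrite gt_eqF ?prod_pmf_gt0.
have mq : mass q S != 0 by rewrite gt_eqF ?(mass_gt0 hq S0).
have mp : mass p S != 0 by rewrite gt_eqF ?(mass_gt0 hp S0).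
split=> [eq_qp x xS|orth x xS].
  rewrite mulmxBr; apply/eqP; rewrite subr_eq0; apply/eqP/rowP => i.
  rewrite ord1; apply: expR_inj.
  have := eq_qp _ S0; have := eq_qp _ xS; rewrite /trunc_pmf S0 xS.
  rewrite (prod_pmf_expR x hp) (prod_pmf_expR x hq) => eqx eq0.
  apply: (mulfI (mulf_neq0 q0 (invr_neq0 mq))).
  by rewrite mulrAC eqx mulrAC eq0.
pose c := prod_pmf q (origin d) / prod_pmf p (origin d).
have qcp y : y \in S -> prod_pmf q y = c * prod_pmf p y.
  move=> /orth; rewrite mulmxBr => /eqP; rewrite subr_eq0 => /eqP eqy.
  by rewrite !(@prod_pmf_expR _ y) // eqy /c mulrA divfK.
have mqcp : mass q S = c * mass p S by rewrite mulr_sumr; apply: eq_bigr.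
have c0 : c != 0 by rewrite mulf_neq0 ?invr_neq0.
by rewrite /trunc_pmf xS qcp // mqcp -mulf_div divff // mul1r.
Qed.

(** A vector [v] orthogonal to [S] could be added to the logits of [p] without changing the
    truncation, so identifiability forces [v = 0]. *)
Lemma identifiable_row_full p S : open_unit p -> origin d \in S ->
  identifiable p S ->
  row_full (\matrix_(k < #|S|) vec_of R (enum_val k)).
Proof.
move=> hp S0 idp; set A := \matrix_k _.
(* Full column rank of [A] is restated as triviality of the left kernel of [A^T]. *)
rewrite -[row_full A]/(\rank A == d) -mxrank_tr -/(row_free A^T) -kermx_eq0.
apply/rowV0P => v /sub_kermxP vA0.
pose q := [ffun i => sigmoid (logit (p i) + v 0 i)] : {ffun 'I_d -> R}.
have hq : open_unit q by move=> i; rewrite ffunE sigmoid_unit.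
have qpv : logit_col q - logit_col p = v^T.
  by apply/colP => i; rewrite !mxE ffunE sigmoidK addrC addKr.
have Av0 : A *m v^T = 0 by rewrite -[A]trmxK -trmx_mul vA0 trmx0.
suff eqqp : q = p by apply: trmx_inj; rewrite -qpv eqqp subrr trmx0.
apply: idp => //; apply/(eq_trunc_pmfP hp hq S0) => x xS.
have := congr1 (row (enum_rank_in xS x)) Av0.
by rewrite qpv row_mul rowK enum_rankK_in // row0.
Qed.

Lemma identifiable_spanning p S : open_unit p -> origin d \in S ->
  identifiable p S <-> spanning_condition p S.
Proof.
move=> hp S0; split=> [idp|[_ [x [xS freex _]]] q hq eq_qp].
  have full := identifiable_row_full hp S0 idp.
  split; first by rewrite trunc_pmf_gt0.
  (* [fullrankfun] selects [d] independent rows of the matrix listing [S]. *)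
  exists (fun j => enum_val (fullrankfun full j)).
  split=> [j||j]; rewrite ?trunc_pmf_gt0 ?enum_valP //.
  have -> : \matrix_j vec_of R (enum_val (fullrankfun full j)) =
      rowsub (fullrankfun full) (\matrix_(k < #|S|) vec_of R (enum_val k)).
    by apply/row_matrixP => j; rewrite row_rowsub !rowK.
  exact: fullrowsub_free.
have orth := (eq_trunc_pmfP hp hq S0).1 eq_qp.
move: freex; set B := \matrix_j _; rewrite row_free_unit => Bunit.
have : logit_col q - logit_col p = 0.
  (* The invertible [B] annihilates the logit difference, which therefore vanishes. *)
  rewrite -[LHS](mulKmx Bunit) (_ : B *m _ = 0) ?mulmx0 //.
  by apply/row_matrixP => j; rewrite row_mul rowK orth // row0.
move=> /eqP; rewrite subr_eq0 => /eqP/colP eql; apply/ffunP => i.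
by have := eql i; rewrite !mxE => /(congr1 (@sigmoid R)); rewrite !logitK.
Qed.

End Identifiability.

(** Both readings of normalization are covered: some flip works, and every flip bringing the origin
    into the set works. *)
Theorem lemma2 (R : realType) (d : nat) (p : {ffun 'I_d -> R})
    (S : {set cube d}) (hp : open_unit p) (hS : S != set0) :
  (identifiable p S <->
     exists a : cube d, spanning_condition (flip_param a p) (flip_set a S)) /\
  (forall a : cube d, origin d \in flip_set a S ->
     (identifiable p S <->
        spanning_condition (flip_param a p) (flip_set a S))).
Proof.
have normalized a : origin d \in flip_set a S ->
    identifiable p S <-> spanning_condition (flip_param a p) (flip_set a S).
  move=> S0; rewrite -(identifiable_flip a).
  by apply: identifiable_spanning => //; exact: open_unit_flip.
split=> //; split=> [idp|[a spana]].
  (* Any point of [S], used as a flip, sends itself to the origin. *)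
  have /set0Pn[x xS] := hS; exists x.
  by apply/normalized => //; rewrite -(flip_self x) mem_flip_set.
apply/(normalized a) => //; have [+ _] := spana.
by rewrite trunc_pmf_gt0 //; exact: open_unit_flip.
Qed.
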